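(* Fix $\rho\in(0,1)$. For each $n$ let $X=(X_1,\dots,X_n)'$ be jointly normal with $E[X_i]=0$, $E[X_i^2]=1$ and $\operatorname{Corr}(X_i,X_j)=\rho$ for $i\neq j$, and let $M_n(X)=\max(X_1,\dots,X_n)$. Let $\widehat\rho=\widehat\rho_n$ be an estimator (a measurable function of $X$ with values in $[0,1)$) satisfying $\sqrt{2\ln n}\,\big(\sqrt{1-\rho}-\sqrt{1-\widehat\rho}\big)\xrightarrow{P}0$. Then $$\left|\int_{-\infty}^{\infty}\left(\Phi^n\!\left(\frac{x\sqrt{\rho}+M_n(X)}{\sqrt{1-\rho}}\right)-\Phi^n\!\left(\frac{x\sqrt{\widehat\rho}+M_n(X)}{\sqrt{1-\widehat\rho}}\right)\right)\phi(x)\,dx\right|\xrightarrow[n\to\infty]{P}0,$$ so that the one-sided $p$-value $1-\int\Phi^n\big((x\sqrt{r}+M_n(X))/\sqrt{1-r}\big)\phi(x)dx$ evaluated at $r=\widehat\rho$ minus the same quantity at $r=\rho$ converges to $0$ in probability.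
   Context: $\Phi$ and $\phi$ denote the standard normal cumulative distribution function and density; $\Phi^n$ is the $n$-th power of $\Phi$. The correlation $\rho$ does not depend on $n$. *)

(* Defs.v *)
From HB Require Import structures.
From mathcomp Require Import all_boot all_order all_algebra.
From mathcomp Require Import all_classical all_reals all_analysis.
Set Implicit Arguments. Unset Strict Implicit. Unset Printing Implicit Defensive.
Import Order.TTheory GRing.Theory Num.Theory.
Import numFieldNormedType.Exports.
Local Open Scope classical_set_scope.
Local Open Scope ring_scope.

Definition std_phi {R : realType} (x : R) : R := normal_pdf 0 1 x.
Definition std_Phi {R : realType} (x : R) : R :=
  fine (normal_prob 0 1 `]-oo, x]).

(* maximum of a finite family x_0, ..., x_{n-1} (meaningful for n >= 1) *)
Definition Mn {R : realType} (n : nat) (x : 'I_n -> R) : R :=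
  fine (\big[Order.max/-oo%E]_(i < n) (x i)%:E).

(* Law of a real random variable Y is N(0, v), v >= 0
   (v = 0 : the degenerate law concentrated at 0). *)
Definition centered_normal_law d (T : measurableType d) (R : realType)
  (P : probability T R) (Y : T -> R) (v : R) : Prop :=
  forall A : set R, measurable A ->
    P (Y @^-1` A) =
      (if v == 0 then (\1_A (0 : R))%:E else normal_prob 0 (Num.sqrt v) A).

Definition jointly_normal0 d (T : measurableType d) (R : realType)
  (P : probability T R) (n : nat) (X : 'I_n -> T -> R)
  (S : 'I_n -> 'I_n -> R) : Prop :=
  forall a : 'I_n -> R,
    centered_normal_law P (fun w => \sum_(i < n) a i * X i w)
      (\sum_(i < n) \sum_(j < n) a i * S i j * a j).

Definition equicorr {R : realType} {n : nat} (rho : R) : 'I_n -> 'I_n -> R :=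
  fun i j => if i == j then 1 else rho.

Definition cvg_prob0 d (T : measurableType d) (R : realType)
  (P : probability T R) (Y : nat -> T -> R) : Prop :=
  forall eps : R, 0 < eps ->
    (P [set w | eps < `|Y n w|]) @[n --> \oo] --> 0%E.

(* Main.v *)
Require Import Defs.
From HB Require Import structures.
From mathcomp Require Import all_boot all_order all_algebra.
From mathcomp Require Import all_classical all_reals all_analysis.
From mathcomp Require Import measurable_realfun ring lra.
Import Order.TTheory GRing.Theory Num.Theory.
Import numFieldNormedType.Exports.
Local Open Scope classical_set_scope.
Local Open Scope ring_scope.

(** With [b_n = sqrt (2 ln n)], the function [Phi^n] is nearly a unit step at
    [b_n]: for every fixed [t > 0] it tends to 0 at [b_n - t] and to 1 at
    [b_n + t]. Hence the integral with parameters [a = sqrt r],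
    [b = sqrt (1 - r)] and maximum [m] is nearly [1 - Phi ((b * b_n - m) / a)].
    Now [Phi] is Lipschitz, and so is [Phi (p / a)] as a function of [a], with a
    constant that does not depend on [p] because [x * phi x] is bounded. So
    this quantity moves little, uniformly in [m], when [b_n * b] and [a] do. *)

Set Implicit Arguments.
Unset Strict Implicit.

Lemma bernoulli_ineq {R : realDomainType} (x : R) n :
  0 <= x -> 1 + n%:R * (x - 1) <= x ^+ n.
Proof.
move=> x0; elim: n => [|n IH]; first by rewrite mul0r addr0.
rewrite exprS -natr1.
have := mulr_ge0 (ler0n R n) (sqr_ge0 (x - 1)).
have := ler_wpM2l x0 IH; lra.
Qed.

Section powers.
Context {R : realType}.
Implicit Types (x : R) (u : R^nat) (n : nat).

Lemma expr_le_expR x n : 0 <= x -> x ^+ n <= expR (n%:R * (x - 1)).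
Proof.
move=> x0; rewrite mulrC expRM_natr lerXn2r ?nnegrE ?expR_ge0//.
by apply: le_trans (expR_ge1Dx _); lra.
Qed.

Lemma expn_cvg1 u : (forall n, 0 <= u n <= 1) ->
  n%:R * (1 - u n) @[n --> \oo] --> (0 : R) ->
  u n ^+ n @[n --> \oo] --> (1 : R).
Proof.
move=> u01 nu0; apply: (@squeeze_cvgr _ _ _ _ (fun n => 1 - n%:R * (1 - u n))
  (cst 1)); last exact: cvg_cst.
- near=> n; have /andP[u0 u1] := u01 n; rewrite exprn_ile1// andbT.
  by have := bernoulli_ineq n u0; lra.
- by rewrite -[X in _ --> X]subr0; apply: cvgB => //; exact: cvg_cst.
Unshelve. all: by end_near. Qed.

Lemma expn_cvg0 u : (forall n, 0 <= u n) ->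
  n%:R * (1 - u n) @[n --> \oo] --> +oo -> u n ^+ n @[n --> \oo] --> (0 : R).
Proof.
move=> u0 nuy; apply: (@squeeze_cvgr _ _ _ _ (cst 0)
  (fun n => expR (- (n%:R * (1 - u n))))); last first.
- exact: (cvg_comp _ _ nuy (@cvgr_expR R)).
- exact: cvg_cst.
near=> n; rewrite exprn_ge0//= -mulrN opprB.
exact: expr_le_expR.
Unshelve. all: by end_near. Qed.

End powers.

Lemma is_derive_lipschitz {R : realType} (I : interval R) (f df : R -> R) k :
  (forall x, x \in I -> is_derive x 1 f (df x)) ->
  (forall x, x \in I -> `|df x| <= k) ->
  {in I &, forall x y, `|f x - f y| <= k * `|x - y|}.
Proof.
move=> fdf dfk x y; wlog xy : x y / x <= y => [wlogxy xI yI|xI yI].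
  have [/wlogxy//|/ltW yx] := leP x y; first exact.
  by rewrite distrC (distrC x) wlogxy.
have zI z : x <= z <= y -> z \in I by exact: (interval_is_interval xI yI).
have [| |z + fE] := @MVT_segment R f df x y xy.
- by move=> z; rewrite in_itv/= => /andP[/ltW xz /ltW zy]; apply/fdf/zI/andP.
- apply: derivable_within_continuous => z; rewrite in_itv/= => /zI/fdf.
  by case.
rewrite in_itv/= => /zI /dfk dfz.
by rewrite distrC fE normrM (distrC x) ler_wpM2r.
Qed.

Section std_normal.
Context {R : realType}.
Implicit Types a c p q u x y : R.
Local Notation mu := (@lebesgue_measure R).
Local Notation peak := (@normal_peak R 1).

Lemma std_phiE x : std_phi x = peak * expR (- x ^+ 2 / 2).
Proof.
by rewrite /std_phi normal_pdfE ?oner_neq0// /normal_fun subr0 expr1n.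
Qed.

Lemma std_phi_ge0 x : 0 <= std_phi x.
Proof. exact: normal_pdf_ge0. Qed.

Lemma peak_gt0 : 0 < peak.
Proof. by rewrite normal_peak_gt0// oner_neq0. Qed.

Lemma std_phi_le_peak x : std_phi x <= peak.
Proof. by rewrite normal_pdf_ub ?oner_neq0. Qed.

Lemma normrM_std_phi_le_peak x : `|x| * std_phi x <= peak.
Proof.
rewrite std_phiE mulrCA ger_pMr ?peak_gt0// mulNr expRN ler_pdivrMr ?expR_gt0//.
rewrite mul1r (le_trans _ (expR_ge1Dx _))// -real_normK ?num_real//.
by have := sqr_ge0 (`|x| - 1); lra.
Qed.

Lemma integrable_std_phi : mu.-integrable setT (EFin \o (@std_phi R)).
Proof. exact: integrable_normal_pdf. Qed.

Lemma Rintegral_std_phi : \int[mu]_x std_phi x = 1 :> R.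
Proof. by rewrite /Rintegral integral_normal_pdf. Qed.

Lemma std_Phi_ge0 x : 0 <= std_Phi x.
Proof. exact/fine_ge0. Qed.

Lemma std_Phi_le1 x : std_Phi x <= 1.
Proof.
by rewrite -lee_fin fineK ?fin_num_measure//; exact: probability_le1.
Qed.

Lemma onem_std_Phi x : 1 - std_Phi x = \int[mu]_(z in `]x, +oo[) std_phi z.
Proof.
rewrite -(@Rintegral_itvB _ _ -oo%O +oo%O)// set_itvNyy.
  by rewrite Rintegral_std_phi.
exact: integrable_std_phi.
Qed.

Lemma is_derive_std_Phi x : is_derive x 1 std_Phi (std_phi x).
Proof.
have intphi : mu.-integrable `]-oo, (x + 1)] (EFin \o (@std_phi R)).
  exact: integrableS integrable_std_phi.
have phix : {for x, continuous (@std_phi R)}.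
  by apply: continuous_normal_pdf; exact: oner_neq0.
have [|dPhi PhiE] := continuous_FTC1 _ intphi (ltNyr x) phix.
  by rewrite ltrDl.
by split; [exact: dPhi|rewrite -derive1E PhiE].
Qed.

Lemma std_Phi_MVT x y : x <= y ->
  exists2 z, x <= z <= y & std_Phi y - std_Phi x = std_phi z * (y - x).
Proof.
move=> xy; have [|z] := MVT_segment xy (fun z _ => is_derive_std_Phi z).
  apply: derivable_within_continuous => z _.
  by case: (is_derive_std_Phi z).
by rewrite in_itv; exists z.
Qed.

Lemma std_Phi_nondecreasing : {homo @std_Phi R : x y / x <= y}.
Proof.
move=> x y xy; rewrite -subr_ge0; have [z _ ->] := std_Phi_MVT xy.
by rewrite mulr_ge0 ?std_phi_ge0 ?subr_ge0.
Qed.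

Lemma std_PhiB_ge x y : 0 <= x <= y ->
  std_phi y * (y - x) <= std_Phi y - std_Phi x.
Proof.
move=> /andP[x0 xy]; have [z /andP[xz zy] ->] := std_Phi_MVT xy.
rewrite ler_wpM2r ?subr_ge0// !std_phiE ler_pM2l ?peak_gt0// ler_expR.
rewrite !mulNr lerN2 ler_pM2r ?invr_gt0// ler_sqr// nnegrE.
  exact: le_trans xz.
exact: le_trans (le_trans xz zy).
Qed.

Lemma std_Phi_lipschitz x y : `|std_Phi x - std_Phi y| <= peak * `|x - y|.
Proof.
apply: (@is_derive_lipschitz R `]-oo, +oo[ _ std_phi) => //.
- by move=> z _; exact: is_derive_std_Phi.
- by move=> z _; rewrite ger0_norm ?std_phi_ge0// std_phi_le_peak.
Qed.

(* With [z = p / t], the derivative of [std_Phi (p / t)] in [t] is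
   [- z * std_phi z / t], and [z * std_phi z] is bounded. *)
Lemma std_Phi_div_lipschitz p c : 0 < c -> {in `[c, +oo[ &, forall a a',
  `|std_Phi (p / a) - std_Phi (p / a')| <= peak / c * `|a - a'|}.
Proof.
move=> c0; apply: (@is_derive_lipschitz R _ (fun t => std_Phi (p / t))
  (fun t => std_phi (p / t) * (p * - t ^- 2))) => t;
  rewrite in_itv/= andbT => ct; have t0 : 0 < t by exact: lt_le_trans ct.
  apply: is_derive1_comp; first exact: is_derive_std_Phi.
  apply: is_deriveZ.
  apply: is_derive_eq; first by apply: is_deriveV; rewrite gt_eqF.
  by rewrite scaler1.
rewrite [X in `|X|](_ : _ = - (p / t * std_phi (p / t) / t)); last first.
  by field; rewrite gt_eqF.
rewrite normrN !normrM [`|std_phi _|]ger0_norm ?std_phi_ge0// -normrM.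
rewrite [X in _ * X]gtr0_norm ?invr_gt0//.
by rewrite ler_pM ?mulr_ge0 ?std_phi_ge0 ?invr_ge0 ?(ltW t0)
  ?normrM_std_phi_le_peak// lef_pV2.
Qed.

Lemma std_Phi_quotient_lipschitz q q' a a' c : 0 < c -> c <= a -> c <= a' ->
  `|std_Phi (q / a) - std_Phi (q' / a')| <= peak / c * (`|q - q'| + `|a - a'|).
Proof.
move=> c0 ca ca'; have a0 : 0 < a by exact: lt_le_trans ca.
rewrite -(subrKA (std_Phi (q' / a))) (le_trans (ler_normD _ _))// mulrDr.
rewrite lerD//; last by rewrite std_Phi_div_lipschitz// in_itv/= andbT.
rewrite (le_trans (std_Phi_lipschitz _ _))// -mulrBl normrM.
rewrite (gtr0_norm (x := a^-1)).
  rewrite -mulrA ler_pM2l ?peak_gt0// mulrC ler_wpM2r//.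
  by rewrite lef_pV2// posrE.
by rewrite invr_gt0.
Qed.

(* The density at [x >= u >= 0] is at most [expR (- u ^+ 2 / 2)] times that of
   the normal law centred at [u], because [x ^+ 2 >= u ^+ 2 + (x - u) ^+ 2]. *)
Lemma std_Phi_tail u : 0 <= u -> 1 - std_Phi u <= expR (- u ^+ 2 / 2).
Proof.
move=> u0; rewrite onem_std_Phi; set w := expR _.
have iu : mu.-integrable `]u, +oo[ (EFin \o normal_pdf u 1).
  by apply: integrableS (integrable_normal_pdf u 1).
apply: (@le_trans _ _ (\int[mu]_(x in `]u, +oo[) (w * normal_pdf u 1 x))).
  apply: le_Rintegral => //.
  - exact: integrableS integrable_std_phi.
  - exact: (integrableZl _ _ iu).
  move=> x; rewrite /= in_itv/= andbT => ux.
  rewrite std_phiE normal_pdfE ?oner_neq0// mulrCA ler_pM2l ?peak_gt0//.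
  rewrite /normal_fun /w -expRD ler_expR expr1n.
  by have := ler_wpM2r u0 (ltW ux); lra.
rewrite RintegralZl// ler_piMr ?expR_ge0//.
rewrite -[leLHS]/(fine (normal_prob u 1 `]u, +oo[)).
by rewrite -lee_fin fineK ?fin_num_measure//; exact: probability_le1.
Qed.

End std_normal.

Section sqrt_2ln.
Context {R : realType}.
Implicit Types (t : R) (n : nat).
Local Notation peak := (@normal_peak R 1).
Local Notation b_ n := (Num.sqrt (2 * ln (n%:R : R))).

Lemma sqrt_2ln_cvgy : b_ n @[n --> \oo] --> +oo.
Proof.
apply/cvgryPge => A; near=> n.
have expA_le_n : expR (A ^+ 2 / 2) <= n%:R by near: n; exact: nbhs_infty_ger.
have n_gt0 : 0 < n%:R :> R by rewrite (lt_le_trans _ expA_le_n)// expR_gt0.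
rewrite (le_trans (ler_norm A))// -sqrtr_sqr ler_wsqrtr//.
have : A ^+ 2 / 2 <= ln (n%:R : R).
  by rewrite -[leLHS]expRK ler_ln// posrE expR_gt0.
lra.
Unshelve. all: by end_near. Qed.

Lemma mulr_sqrt_2ln_cvgy t : 0 < t -> t * b_ n @[n --> \oo] --> +oo.
Proof.
move=> t0; have mul_cvgy : t * x @[x --> +oo] --> +oo by exact: gt0_cvgMry.
exact: (cvg_comp _ _ sqrt_2ln_cvgy mul_cvgy).
Qed.

Lemma natr_expRN_sqrt_2ln n : (0 < n)%N ->
  n%:R * expR (- b_ n ^+ 2 / 2) = 1 :> R.
Proof.
move=> n_gt0; have n_ge1 : 1 <= n%:R :> R by rewrite ler1n.
rewrite sqr_sqrtr ?mulr_ge0 ?ln_ge0// mulNr mulrAC divff ?pnatr_eq0// mul1r.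
by rewrite expRN lnK ?posrE ?ltr0n// divff// pnatr_eq0 -lt0n.
Qed.

Lemma std_Phi_expn_cvg1 t : 0 < t ->
  std_Phi (b_ n + t) ^+ n @[n --> \oo] --> (1 : R).
Proof.
move=> t0; apply: (@expn_cvg1 R (fun n => std_Phi (b_ n + t))) => [n|].
  by rewrite std_Phi_ge0 std_Phi_le1.
apply: (@squeeze_cvgr _ _ _ _ (cst 0) (fun n => expR (- (t * b_ n)))).
- near=> n; rewrite mulr_ge0 ?subr_ge0 ?std_Phi_le1//=.
  have n_gt0 : (0 < n)%N by near: n; exact: nbhs_infty_gt.
  have bt_ge0 : 0 <= b_ n + t by rewrite addr_ge0// ltW.
  apply: (@le_trans _ _
    (n%:R * (expR (- b_ n ^+ 2 / 2) * expR (- (t * b_ n))))).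
    rewrite ler_wpM2l// (le_trans (std_Phi_tail bt_ge0))// -expRD ler_expR.
    have := sqr_ge0 t; lra.
  by rewrite mulrA natr_expRN_sqrt_2ln// mul1r.
- exact: cvg_cst.
- exact: (cvg_comp _ _ (mulr_sqrt_2ln_cvgy t0) (@cvgr_expR R)).
Unshelve. all: by end_near. Qed.

Lemma std_Phi_expn_cvg0 t : 0 < t ->
  std_Phi (b_ n - t) ^+ n @[n --> \oo] --> (0 : R).
Proof.
move=> t0; apply: (@expn_cvg0 R (fun n => std_Phi (b_ n - t))) => [n|].
  exact: std_Phi_ge0.
pose C := peak * expR (- t ^+ 2 / 8) * (t / 2) * (t / 2).
have C0 : 0 < C by rewrite !mulr_gt0 ?peak_gt0 ?expR_gt0 ?invr_gt0.
apply: (@ger_cvgy _ _ _ _ (fun n => C * b_ n)); last first.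
  exact: mulr_sqrt_2ln_cvgy.
near=> n.
have n_gt0 : (0 < n)%N by near: n; exact: nbhs_infty_gt.
have t_le_b : t <= b_ n by near: n; exact: (cvgry_ge sqrt_2ln_cvgy).
set b := Num.sqrt _ in t_le_b *.
have tail : std_phi (b - t / 2) * (t / 2) <= 1 - std_Phi (b - t).
  have t_eq : t / 2 = b - t / 2 - (b - t) by lra.
  rewrite [X in _ * X]t_eq (le_trans (std_PhiB_ge _)) ?lerD2r ?std_Phi_le1//.
  by apply/andP; split; lra.
apply: le_trans (ler_wpM2l (ler0n R n) tail); rewrite std_phiE.
have -> : - (b - t / 2) ^+ 2 / 2
    = - b ^+ 2 / 2 + (- t ^+ 2 / 8 + t / 2 * b) by field.
rewrite !expRD [leRHS](_ : _ = n%:R * expR (- b ^+ 2 / 2) *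
  (peak * expR (- t ^+ 2 / 8) * (t / 2) * expR (t / 2 * b))); last ring.
rewrite natr_expRN_sqrt_2ln// mul1r /C -[leLHS]mulrA ler_wpM2l//.
  by rewrite !mulr_ge0 ?(ltW peak_gt0) ?expR_ge0 ?invr_ge0 ?ltW.
by apply: le_trans (expR_ge1Dx _); lra.
Unshelve. all: by end_near. Qed.

End sqrt_2ln.

Section weighted_integral.
Context d (T : measurableType d) (R : realType).
Variables (mu : {measure set T -> \bar R}) (p : T -> R).
Hypothesis int_p : mu.-integrable setT (EFin \o p).
Hypothesis p_ge0 : forall x, 0 <= p x.
Implicit Types (A : set T) (g : T -> R) (e k : R).

Lemma integrable_bounded_mul g k : measurable_fun setT g ->
  (forall x, `|g x| <= k) -> mu.-integrable setT (EFin \o (fun x => g x * p x)).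
Proof.
move=> mg gk; have bg : [bounded g x | x in setT].
  exists k; split; first exact: num_real.
  by move=> x /ltW kx y _; exact: le_trans kx.
exact: integrableMr int_p.
Qed.

Lemma integrable_indicD_mul A e : measurable A ->
  mu.-integrable setT (EFin \o (fun x => (\1_A x + e) * p x)).
Proof.
move=> mA; apply: (@integrable_bounded_mul _ (1 + `|e|)) => [|x].
  exact: measurable_funD.
by rewrite (le_trans (ler_normD _ _))// lerD2r indicE ger0_norm// lern1 leq_b1.
Qed.

Lemma Rintegral_indicD_mul A e : measurable A ->
  \int[mu]_x ((\1_A x + e) * p x) = \int[mu]_(x in A) p x + e * \int[mu]_x p x.
Proof.
move=> mA.
have int_indic : mu.-integrable setT (EFin \o (fun x => \1_A x * p x)).
  by have := integrable_indicD_mul 0 mA; under eq_fun do rewrite addr0.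
under eq_Rintegral do rewrite mulrDl.
rewrite RintegralD ?RintegralZl//; last first.
  exact: (@integrable_bounded_mul (cst e) `|e|).
rewrite [in RHS]Rintegral_mkcond; congr (_ + _).
apply: eq_Rintegral => x _; rewrite patchE indicE.
by case: (x \in A); rewrite ?mul1r ?mul0r.
Qed.

Lemma Rintegral_mul_le_indicD A g e : measurable A ->
  mu.-integrable setT (EFin \o (fun x => g x * p x)) ->
  (forall x, g x <= \1_A x + e) ->
  \int[mu]_x (g x * p x) <= \int[mu]_(x in A) p x + e * \int[mu]_x p x.
Proof.
move=> mA ig gA; rewrite -Rintegral_indicD_mul//.
apply: le_Rintegral => // [|x _]; first exact: integrable_indicD_mul.
by rewrite ler_wpM2r.
Qed.

Lemma Rintegral_mul_ge_indicB A g e : measurable A ->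
  mu.-integrable setT (EFin \o (fun x => g x * p x)) ->
  (forall x, \1_A x - e <= g x) ->
  \int[mu]_(x in A) p x - e * \int[mu]_x p x <= \int[mu]_x (g x * p x).
Proof.
move=> mA ig gA; rewrite -mulNr -Rintegral_indicD_mul//.
apply: le_Rintegral => // [|x _]; first exact: integrable_indicD_mul.
by rewrite ler_wpM2r.
Qed.

End weighted_integral.

(* [E (f ((a * Z + m) / b))] for a standard normal [Z] *)
Definition normal_mean {R : realType} (f : R -> R) (a b m : R) : R :=
  \int[lebesgue_measure]_x (f ((x * a + m) / b) * std_phi x).

Section normal_mean.
Context {R : realType}.
Variable f : R -> R.
Hypotheses (f_nd : {homo f : x y / x <= y}) (f01 : forall x, 0 <= f x <= 1).
Implicit Types a b c e l m t u B : R.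
Local Notation mu := (@lebesgue_measure R).
Local Notation peak := (@normal_peak R 1).

Lemma integrable_normal_mean a b m :
  mu.-integrable setT (EFin \o (fun x => f ((x * a + m) / b) * std_phi x)).
Proof.
apply: (@integrable_bounded_mul _ _ _ _ _ integrable_std_phi _ 1) => [|x].
  apply: (measurableT_comp (f := f)); first exact: nondecreasing_measurable.
  apply: measurable_funM => //; apply: measurable_funD => //.
  exact: measurable_funM.
by have /andP[f0 f1] := f01 ((x * a + m) / b); rewrite ger0_norm.
Qed.

Lemma normal_mean_le a b m l e : 0 < a -> 0 < b -> f l <= e ->
  normal_mean f a b m <= 1 - std_Phi ((b * l - m) / a) + e.
Proof.
move=> a0 b0 fl; have e0 : 0 <= e by apply: le_trans fl; case/andP: (f01 l).
rewrite onem_std_Phi -[X in _ + X]mulr1 -(@Rintegral_std_phi R).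
apply: Rintegral_mul_le_indicD => // [|||x].
- exact: integrable_std_phi.
- exact: std_phi_ge0.
- exact: integrable_normal_mean.
rewrite indicE; have /andP[_ f1] := f01 ((x * a + m) / b).
case: (boolP (x \in _)) => [_|]; first by rewrite (le_trans f1)// lerDl.
rewrite notin_setE/= in_itv/= andbT add0r => /negP; rewrite -leNgt => xs.
rewrite (le_trans _ fl)// f_nd// ler_pdivrMr// [leRHS]mulrC -lerBrDr.
by rewrite -ler_pdivlMr.
Qed.

Lemma normal_mean_ge a b m u e : 0 < a -> 0 < b -> 1 - e <= f u ->
  1 - std_Phi ((b * u - m) / a) - e <= normal_mean f a b m.
Proof.
move=> a0 b0 fu; have e0 : 0 <= e by have /andP[_ fu1] := f01 u; lra.
rewrite onem_std_Phi -[X in _ - X]mulr1 -(@Rintegral_std_phi R).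
apply: Rintegral_mul_ge_indicB => // [|||x].
- exact: integrable_std_phi.
- exact: std_phi_ge0.
- exact: integrable_normal_mean.
rewrite indicE; have /andP[f0 _] := f01 ((x * a + m) / b).
case: (boolP (x \in _)) => [|_]; last first.
  by rewrite (le_trans _ f0)// sub0r oppr_le0.
rewrite inE/= in_itv/= andbT => /ltW xs.
rewrite (le_trans fu)// f_nd// ler_pdivlMr// [leLHS]mulrC -lerBlDr.
by rewrite -ler_pdivrMr.
Qed.

Lemma normal_meanB_le B t e a b a' b' c m :
  0 < c -> c <= a -> c <= a' -> 0 < b <= 1 -> 0 < b' <= 1 -> 0 <= t ->
  f (B - t) <= e -> 1 - e <= f (B + t) ->
  normal_mean f a b m - normal_mean f a' b' m <=
    peak / c * (`|B * (b - b')| + 2 * t + `|a - a'|) + 2 * e.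
Proof.
move=> c0 ca ca' /andP[b0 b1] /andP[b'0 b'1] t0 flo fhi.
have a0 : 0 < a by exact: lt_le_trans ca.
have a'0 : 0 < a' by exact: lt_le_trans ca'.
have ub := normal_mean_le m a0 b0 flo.
have lb := normal_mean_ge m a'0 b'0 fhi.
set q := b * (B - t) - m in ub; set q' := b' * (B + t) - m in lb.
have qq' : `|q' - q| <= `|B * (b - b')| + 2 * t.
  have -> : q' - q = (b + b') * t - B * (b - b') by rewrite /q /q'; ring.
  rewrite (le_trans (ler_normB _ _))// addrC lerD2l.
  rewrite ger0_norm ?mulr_ge0 ?addr_ge0 ?(ltW b0) ?(ltW b'0)//.
  by rewrite ler_wpM2r//; lra.
have PhiB : std_Phi (q' / a') - std_Phi (q / a) <=
    peak / c * (`|B * (b - b')| + 2 * t + `|a - a'|).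
  rewrite (le_trans (ler_norm _))// distrC.
  rewrite (le_trans (std_Phi_quotient_lipschitz _ _ c0 ca ca'))//.
  rewrite ler_wpM2l ?divr_ge0 ?(ltW peak_gt0) ?(ltW c0)//.
  by rewrite lerD2r distrC.
lra.
Qed.

End normal_mean.

Lemma sqrt_onem_le1 {R : rcfType} (x : R) : 0 <= x -> Num.sqrt (1 - x) <= 1.
Proof. by move=> x0; rewrite -[leRHS]sqrtr1 ler_wsqrtr// gerBl. Qed.

Lemma mul_dist_sqrt_le {R : rcfType} (r s : R) : 0 <= r <= 1 -> 0 <= s <= 1 ->
  Num.sqrt r * `|Num.sqrt r - Num.sqrt s| <=
    2 * `|Num.sqrt (1 - r) - Num.sqrt (1 - s)|.
Proof.
move=> /andP[r0 r1] /andP[s0 s1].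
apply: (@le_trans _ _ `|(Num.sqrt r - Num.sqrt s) * (Num.sqrt r + Num.sqrt s)|).
  by rewrite normrM mulrC ler_wpM2l// ger0_norm ?addr_ge0 ?sqrtr_ge0// lerDl.
rewrite -subr_sqr !sqr_sqrtr// (_ : r - s = (1 - s) - (1 - r)); last ring.
rewrite -[X in `|X - _|]sqr_sqrtr ?subr_ge0//.
rewrite -[X in `|_ - X|]sqr_sqrtr ?subr_ge0//.
rewrite subr_sqr normrM distrC mulrC ler_wpM2r//.
by rewrite ger0_norm ?addr_ge0 ?sqrtr_ge0// -[2]/(1 + 1) lerD// sqrt_onem_le1.
Qed.

Lemma dist_sqrt_le {R : rcfType} (r s c : R) : 0 < r <= 1 -> 0 <= s <= 1 ->
  `|Num.sqrt (1 - r) - Num.sqrt (1 - s)| <= Num.sqrt r * c / 2 ->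
  `|Num.sqrt r - Num.sqrt s| <= c.
Proof.
move=> /andP[r0 r1] s01 onem_le.
have sqrt_r_gt0 : 0 < Num.sqrt r by rewrite sqrtr_gt0.
rewrite -(ler_pM2l sqrt_r_gt0); apply: le_trans (mul_dist_sqrt_le _ s01) _.
  by rewrite ltW.
lra.
Qed.

(* Conditioning on [- Z], this is the distribution function at [m] of the
   maximum of the variables [sqrt r * Z + sqrt (1 - r) * Z_i] for [i < n], where
   [Z] and the [Z_i] are independent standard normal: they are standard normal
   with pairwise correlations [r]. *)
Definition equicorr_max_cdf {R : realType} n (r m : R) : R :=
  normal_mean (fun x => std_Phi x ^+ n) (Num.sqrt r) (Num.sqrt (1 - r)) m.

Section equicorr_max_cdf.
Context {R : realType}.
Implicit Types (B c e m r s t x : R) (n : nat).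
Local Notation mu := (@lebesgue_measure R).
Local Notation peak := (@normal_peak R 1).
Local Notation b_ n := (Num.sqrt (2 * ln (n%:R : R))).

Lemma std_Phi_expn_nondecreasing n :
  {homo (fun x => std_Phi x ^+ n) : x y / x <= y}.
Proof.
by move=> x y xy; rewrite lerXn2r ?nnegrE ?std_Phi_ge0// std_Phi_nondecreasing.
Qed.

Lemma std_Phi_expn_itv01 n x : 0 <= std_Phi x ^+ n <= 1.
Proof. by rewrite exprn_ge0 ?exprn_ile1 ?std_Phi_ge0 ?std_Phi_le1. Qed.

Lemma equicorr_max_cdfB n r s m :
  equicorr_max_cdf n r m - equicorr_max_cdf n s m =
  \int[mu]_x (std_Phi ((x * Num.sqrt r + m) / Num.sqrt (1 - r)) ^+ n * std_phi x
    - std_Phi ((x * Num.sqrt s + m) / Num.sqrt (1 - s)) ^+ n * std_phi x).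
Proof.
have integrable t := integrable_normal_mean (@std_Phi_expn_nondecreasing n)
  (std_Phi_expn_itv01 n) (Num.sqrt t) (Num.sqrt (1 - t)) m.
exact/esym/(RintegralB measurableT (integrable r) (integrable s)).
Qed.

Lemma dist_equicorr_max_cdf_le n B t e c r s m :
  0 < c -> c <= Num.sqrt r -> c <= Num.sqrt s -> 0 <= r < 1 -> 0 <= s < 1 ->
  0 <= t -> std_Phi (B - t) ^+ n <= e -> 1 - e <= std_Phi (B + t) ^+ n ->
  `|equicorr_max_cdf n r m - equicorr_max_cdf n s m| <=
    peak / c * (`|B * (Num.sqrt (1 - r) - Num.sqrt (1 - s))| + 2 * t +
                `|Num.sqrt r - Num.sqrt s|) + 2 * e.
Proof.
move=> c0 cr cs r01 s01 t0 lo hi.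
have sqrt_onem x : 0 <= x < 1 -> 0 < Num.sqrt (1 - x) <= 1.
  by move=> /andP[x0 x1]; rewrite sqrtr_gt0 subr_gt0 x1 sqrt_onem_le1.
have cdfB_le x y : c <= Num.sqrt x -> c <= Num.sqrt y ->
    0 <= x < 1 -> 0 <= y < 1 ->
    equicorr_max_cdf n x m - equicorr_max_cdf n y m <=
    peak / c * (`|B * (Num.sqrt (1 - x) - Num.sqrt (1 - y))| + 2 * t +
                `|Num.sqrt x - Num.sqrt y|) + 2 * e.
  move=> cx cy /sqrt_onem x01 /sqrt_onem y01.
  apply: normal_meanB_le c0 cx cy x01 y01 t0 lo hi.
  - exact: std_Phi_expn_nondecreasing.
  - exact: std_Phi_expn_itv01.
rewrite ler_norml lerNl opprB; apply/andP; split; last exact: cdfB_le.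
rewrite (le_trans (cdfB_le s r cs cr s01 r01)) ?lexx// (distrC (Num.sqrt s)).
by rewrite !normrM (distrC (Num.sqrt (1 - s))) lexx.
Qed.

Lemma equicorr_max_cdf_stable r e : 0 < r < 1 -> 0 < e ->
  exists2 c, 0 < c & \forall n \near \oo, forall s m, 0 <= s < 1 ->
    `|b_ n * (Num.sqrt (1 - r) - Num.sqrt (1 - s))| <= c ->
    `|equicorr_max_cdf n r m - equicorr_max_cdf n s m| <= e.
Proof.
move=> /andP[r0 r1] e0; pose a := Num.sqrt r.
have a0 : 0 < a by rewrite sqrtr_gt0.
have a1 : a <= 1 by rewrite -[leRHS]sqrtr1 ler_wsqrtr// ltW.
(* Three displacements of at most [q] each cost [e / 3] in total. *)
pose q := e * (a / 2) / (9 * peak).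
have q0 : 0 < q by rewrite divr_gt0 ?mulr_gt0 ?peak_gt0.
pose d := Num.min (a / 2) q.
have [d_le_a2 d_le_q] : d <= a / 2 /\ d <= q by rewrite /d !ge_min !lexx orbT.
have d0 : 0 < d by rewrite lt_min q0 divr_gt0.
exists (a * d / 2); first by rewrite divr_gt0// mulr_gt0.
near=> n => s m s01 db; have /andP[s0 s1] := s01.
have b_ge1 : 1 <= b_ n by near: n; exact: (cvgry_ge sqrt_2ln_cvgy).
have lo : std_Phi (b_ n - q / 2) ^+ n <= e / 3.
  by near: n; apply: (cvgr_le _ (std_Phi_expn_cvg0 _)); rewrite divr_gt0.
have hi : 1 - e / 3 <= std_Phi (b_ n + q / 2) ^+ n.
  near: n; apply: (cvgr_ge _ (std_Phi_expn_cvg1 _)); first by rewrite divr_gt0.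
  by rewrite gtrBl divr_gt0.
have da : `|a - Num.sqrt s| <= d.
  apply: dist_sqrt_le; [by rewrite r0 ltW|by rewrite s0 ltW|].
  by apply: le_trans db; rewrite normrM ler_peMl// ger0_norm ?sqrtr_ge0.
have a2_le_s : a / 2 <= Num.sqrt s by move: da; rewrite ler_norml; lra.
apply: le_trans (dist_equicorr_max_cdf_le _ _ _ a2_le_s _ s01 _ lo hi) _.
- exact: divr_gt0.
- by rewrite ler_pdivrMr// mulr_natr mulr2n lerDl ltW.
- by rewrite ltW.
- by rewrite divr_ge0// ltW.
have q_eq : peak / (a / 2) * (q * 3) = e / 3.
  by rewrite /q; field; rewrite !gt_eqF ?peak_gt0.
rewrite -[leRHS](_ : e / 3 + 2 * (e / 3) = e) ?lerD2r -?q_eq; last lra.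
rewrite ler_pM2l ?divr_gt0 ?peak_gt0//.
have ad_le_q : a * d / 2 <= q.
  by apply: le_trans d_le_q; have := ler_wpM2r (ltW d0) a1; lra.
move: db da; rewrite -/a; lra.
Unshelve. all: by end_near. Qed.

End equicorr_max_cdf.

Section measurability.
Context d (T : measurableType d) (R : realType).
Implicit Types (a b g m r : T -> R) (f : R -> R) (e : R).

Lemma measurable_sqrt g : measurable_fun setT g ->
  measurable_fun setT (fun w => Num.sqrt (g w)).
Proof.
apply: measurableT_comp; apply: continuous_measurable_fun.
exact: sqrt_continuous.
Qed.

Lemma measurable_inv_ge0 g : measurable_fun setT g -> (forall w, 0 <= g w) ->
  measurable_fun setT (fun w => (g w)^-1).
Proof.
move=> mg g0; under eq_fun do rewrite -powR_inv1//.
exact: (measurableT_comp (measurable_powR _)).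
Qed.

Lemma measurable_Mn n (X : 'I_n -> T -> R) :
  (forall i, measurable_fun setT (X i)) ->
  measurable_fun setT (fun w => Mn (fun i => X i w)).
Proof.
move=> mX; apply: (measurableT_comp (f := fine)) => //.
elim: (index_enum _) => [|i s IH].
  by under eq_fun do rewrite big_nil; exact: measurable_cst.
under eq_fun do rewrite big_cons.
by apply: measurable_maxe => //; apply/measurable_EFinP.
Qed.

Lemma measurable_normal_mean f a b m :
  {homo f : x y / x <= y} -> (forall x, 0 <= f x) ->
  measurable_fun setT a -> measurable_fun setT b -> (forall w, 0 <= b w) ->
  measurable_fun setT m ->
  measurable_fun setT (fun w => normal_mean f (a w) (b w) (m w)).
Proof.
move=> f_nd f0 ma mb b0 mm; apply: (measurableT_comp (f := fine)) => //.
pose F (z : T * R) := (f ((z.2 * a z.1 + m z.1) / b z.1) * std_phi z.2)%:E.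
apply: (measurable_fun_fubini_tonelli_F (m2 := lebesgue_measure) F); last first.
  by move=> z; rewrite lee_fin mulr_ge0// std_phi_ge0.
apply/measurable_EFinP; apply: measurable_funM; last first.
  exact: (measurableT_comp (measurable_normal_pdf 0 1)).
apply: (measurableT_comp (f := f)); first exact: nondecreasing_measurable.
apply: measurable_funM.
  apply: measurable_funD; last exact: (measurableT_comp mm).
  by apply: measurable_funM => //; exact: (measurableT_comp ma).
exact: (measurableT_comp (measurable_inv_ge0 mb b0)).
Qed.

Lemma measurable_equicorr_max_cdf n r m :
  measurable_fun setT r -> measurable_fun setT m ->
  measurable_fun setT (fun w => equicorr_max_cdf n (r w) (m w)).
Proof.
move=> mr mm; apply: measurable_normal_mean => //.
- exact: std_Phi_expn_nondecreasing.
- by move=> x; have /andP[] := std_Phi_expn_itv01 n x.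
- exact: measurable_sqrt.
- by apply: measurable_sqrt; exact: measurable_funB.
Qed.

Lemma measurable_normr_gt g e : measurable_fun setT g ->
  measurable [set w | e < `|g w|].
Proof.
move=> mg; rewrite -[X in measurable X]setTI.
by apply: measurable_fun_ltr => //; exact: measurableT_comp.
Qed.

Lemma cvg_prob0_near (P : probability T R) (Y Z : nat -> T -> R) :
  (forall n, measurable_fun setT (Y n)) ->
  (forall n, measurable_fun setT (Z n)) ->
  (forall e, 0 < e -> exists2 c, 0 < c &
    \forall n \near \oo, forall w, `|Z n w| <= c -> `|Y n w| <= e) ->
  cvg_prob0 P Z -> cvg_prob0 P Y.
Proof.
move=> mY mZ ZY cvgZ e e0; have [c c0 ZYe] := ZY e e0.
apply: (@squeeze_cvge _ _ _ _ (cst 0%E) _ (fun n => P [set w | c < `|Z n w|]));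
  [|exact: cvg_cst|exact: cvgZ].
near=> n; rewrite measure_ge0/=; apply: le_measure; rewrite ?inE.
- exact: measurable_normr_gt.
- exact: measurable_normr_gt.
- move=> w /=; rewrite !ltNge; apply: contra.
  exact: (near ZYe n).
Unshelve. all: by end_near. Qed.

End measurability.

Unset Implicit Arguments.

Theorem theorem3 (R : realType) (rho : R) (d : measure_display)
  (T : measurableType d) (P : probability T R)
  (X : forall n : nat, 'I_n -> T -> R)
  (rhohat : forall n : nat, ('I_n -> R) -> R) :
  0 < rho < 1 ->
  (forall n i, measurable_fun [set: T] (X n i)) ->
  (forall n, jointly_normal0 P (X n) (@equicorr R n rho)) ->
  (forall n, measurable_fun [set: T] (fun w => rhohat n (fun i => X n i w))) ->
  (forall n x, 0 <= rhohat n x < 1) ->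
  cvg_prob0 P (fun n w => Num.sqrt (2 * ln (n%:R)) *
      (Num.sqrt (1 - rho) - Num.sqrt (1 - rhohat n (fun i => X n i w)))) ->
  cvg_prob0 P (fun n w =>
      `| \int[lebesgue_measure]_(x in [set: R])
           (std_Phi ((x * Num.sqrt rho + Mn (fun i => X n i w))
                       / Num.sqrt (1 - rho)) ^+ n * std_phi x
          - std_Phi ((x * Num.sqrt (rhohat n (fun i => X n i w))
                       + Mn (fun i => X n i w))
                       / Num.sqrt (1 - rhohat n (fun i => X n i w))) ^+ n
            * std_phi x) |).
Proof.
move=> rho01 mX _ mrhohat rhohat01; apply: cvg_prob0_near.
- move=> n; under eq_fun do rewrite -equicorr_max_cdfB.
  apply: measurableT_comp => //.
  by apply: measurable_funB; apply: measurable_equicorr_max_cdf => //;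
    exact: measurable_Mn.
- move=> n; apply: measurable_funM => //; apply: measurable_funB => //.
  by apply: measurable_sqrt; exact: measurable_funB.
- move=> e e0; have [c c0 stable] := equicorr_max_cdf_stable rho01 e0.
  exists c => //; apply: filterS stable => n stable w Zw.
  by rewrite normr_id -equicorr_max_cdfB; exact: stable.
Qed.
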